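(* For any fixed $k\ge 2$, if $m\le \frac{\ln n}{4}$, then with high probability (over the random utilities, as $n\to\infty$) no envy-free outcome exists.
   Context: Random variable-group model: $k\ge2$ is a fixed integer; $N=[n]$ is a set of $n$ agents with $n$ divisible by $k$; $M=[m]$ is a set of $m\ge 1$ goods ($m$ may depend on $n$). All groups have the same desired size $n_1=\dots=n_k=n/k$. A fixed distribution $\mathcal D$ is given that is non-atomic (puts zero probability on every single point) and has support contained in $[0,1]$. For each $a\in N$, $g\in M$, the utility $u_a(g)$ is drawn independently from $\mathcal D$, and utilities are additive: $u_a(M')=\sum_{g\in M'}u_a(g)$. An outcome $(C,A)$ consists of a partition $C=(C_1,\dots,C_k)$ of $N$ with $|C_i|=n/k$ for all $i$, and a complete allocation $A=(A_1,\dots,A_k)$, i.e. a partition of $M$ into $k$ disjoint, possibly empty bundles. It is envy-free if $u_a(A_i)\ge u_a(A_j)$ for all $i,j\in[k]$ and $a\in C_i$. ''With high probability'' means with probability approaching $1$ as $n\to\infty$. *)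

(* Defs.v *)
From HB Require Import structures.
From mathcomp Require Import all_boot all_order all_algebra.
From mathcomp Require Import all_classical all_reals all_analysis.

Set Implicit Arguments.
Unset Strict Implicit.
Unset Printing Implicit Defensive.

Import Order.TTheory GRing.Theory Num.Theory.
Import numFieldNormedType.Exports.

Local Open Scope ring_scope.

Section Outcomes.
Context {R : realType} {k n m : nat}.

(* Ordered partition into k labelled parts, some of which may be empty. *)
Definition labelled_partition (T : finType) (X : 'I_k -> {set T}) : Prop :=
  (forall i j, i != j -> [disjoint X i & X j]) /\
  (forall x, exists i, x \in X i).

Definition outcome (C : 'I_k -> {set 'I_n}) (A : 'I_k -> {set 'I_m}) : Prop :=
  [/\ labelled_partition C,
      (forall i, #|C i| = (n %/ k)%N) &
      labelled_partition A].

Definition bundle_utility (v : 'I_n -> 'I_m -> R) (a : 'I_n) (B : {set 'I_m}) :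
  R := \sum_(g in B) v a g.

Definition envy_free (v : 'I_n -> 'I_m -> R)
    (C : 'I_k -> {set 'I_n}) (A : 'I_k -> {set 'I_m}) : Prop :=
  forall (i j : 'I_k) (a : 'I_n), a \in C i ->
    bundle_utility v a (A j) <= bundle_utility v a (A i).

End Outcomes.

Definition envy_free_outcome_exists {R : realType} (k n m : nat)
    (v : 'I_n -> 'I_m -> R) : Prop :=
  exists (C : 'I_k -> {set 'I_n}) (A : 'I_k -> {set 'I_m}),
    outcome C A /\ envy_free v C A.

Local Open Scope classical_set_scope.

Section Distributions.
Context {R : realType}.

Definition non_atomic (D : probability R R) : Prop :=
  forall x : R, D [set x] = 0%E.

(* Topological support: the smallest closed set of full measure. *)
Definition dist_support (D : probability R R) : set R :=
  [set x | forall U : set R, open U -> U x -> (0 < D U)%E].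

End Distributions.

Section RandomUtilities.
Context {d : measure_display} {T : measurableType d} {R : realType}.
Variable P : probability T R.

(* Mutual independence: product rule for every subfamily (I is finite). *)
Definition mutually_independent (I : finType) (X : I -> {RV P >-> R}) : Prop :=
  forall (J : {set I}) (B : I -> set R), (forall i, measurable (B i)) ->
    P [set w | forall i, i \in J -> B i (X i w)] =
    (\prod_(i in J) P (X i @^-1` B i))%E.

Definition iid_utilities (D : probability R R) (n m : nat)
    (u : 'I_n -> 'I_m -> {RV P >-> R}) : Prop :=
  mutually_independent (fun ag : 'I_n * 'I_m => u ag.1 ag.2) /\
  (forall a g (B : set R), measurable B -> distribution P (u a g) B = D B).

End RandomUtilities.

(* Main.v *)
(* Union bound over all pairs (allocation, balanced partition). Fix an
   allocation without empty bundle and let p_i be the probability that bundle i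
   is a favourite of a given agent. As D has no atoms, ties have probability 0
   and the p_i sum to 1. For a fixed balanced partition, independence gives that
   envy-freeness has probability (prod_i p_i)^(n/k), at most k^-n by AM-GM. There
   are at most k^m allocations and n!/(n/k)!^k balanced partitions, and the
   central multinomial probability n!/((n/k)!^k k^n) is at most
   (n/k + 1)^(-(k-1)/2), while k^m <= n^(ln k / 4) <= n^((k-1)/4); so the union
   bound tends to 0. Allocations with an empty bundle are never envy-free when
   all utilities are positive, which holds almost surely.

   No product measure is used: utilities are rounded to a grid of mesh 1/N, on
   which the events become finite unions of boxes. Rounding turns favourites
   into favourites up to m grid steps, whose probabilities sum to 1 + o(1) as N
   goes to infinity because non-atomicity makes the largest cell mass vanish. *)
Require Import Defs.
From HB Require Import structures.
From mathcomp Require Import all_boot all_order all_algebra.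
From mathcomp Require Import perm zify lra ring.
From mathcomp Require Import all_classical all_reals all_analysis.
From mathcomp Require Import measurable_realfun.

Set Implicit Arguments.
Unset Strict Implicit.
Unset Printing Implicit Defensive.

Import Order.TTheory GRing.Theory Num.Theory.
Import numFieldNormedType.Exports.

Local Open Scope ring_scope.

(** * Counting balanced partitions *)

Definition balanced (n k : nat) (c : {ffun 'I_n -> 'I_k}) : bool :=
  [forall i, #|[set a | c a == i]| == (n %/ k)%N].

(* A balanced colouring together with an ordering of each of its classes is an
   injection of the agents into pairs (colour, rank). *)
Lemma card_balanced (k q : nat) : (0 < k)%N ->
  (#|[set c | @balanced (k * q) k c]| * q`! ^ k <= (k * q)`!)%N.
Proof.
(* With [q = 0] there are no agents; otherwise ranks live in the inhabited type ['I_q.+1], as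
   [inord] requires. *)
move=> k_gt0; case: q => [|q].
  rewrite fact0 exp1n muln1 muln0 fact0.
  by apply: leq_trans (max_card _) _; rewrite card_ffun !card_ord expn0.
set n := (k * q.+1)%N.
have nk : (n %/ k = q.+1)%N by rewrite mulKn.
pose fib (c : {ffun 'I_n -> 'I_k}) (i : 'I_k) := enum [set a | c a == i].
have szfib c i : balanced c -> size (fib c i) = q.+1.
  by move=> /forallP/(_ i)/eqP; rewrite nk -cardE.
pose pos c a : 'I_q.+1 := inord (index a (fib c (c a))).
have posE c a : balanced c -> pos c a = index a (fib c (c a)) :> nat.
  by move=> cb; rewrite inordK// -(szfib c (c a) cb) index_mem mem_enum inE.
pose F (x : {ffun 'I_n -> 'I_k} * {ffun 'I_k -> {perm 'I_q.+1}}) :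
    {ffun 'I_n -> 'I_k * 'I_q.+1} :=
  [ffun a => (x.1 a, x.2 (x.1 a) (pos x.1 a))].
pose D := finset.setX [set c | @balanced n k c]
  [set: {ffun 'I_k -> {perm 'I_q.+1}}].
have cardD : #|D| = (#|[set c | @balanced n k c]| * (q.+1)`! ^ k)%N.
  by rewrite cardsX cardsT card_ffun card_ord card_Sn.
have FD : {in D &, injective F}.
  move=> [c s] [c' s']; rewrite !inE !andbT /= => cb cb' /ffunP FE.
  have cE : c = c' by apply/ffunP => a; have := FE a; rewrite !ffunE /= => -[].
  subst c'; congr pair; apply/ffunP => i; apply/permP => t.
  have a0 : 'I_n by exact: (Ordinal (leq_trans (ltn0Sn _) (leq_pmull _ k_gt0))).
  have ti : (t < size (fib c i))%N by rewrite szfib.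
  pose a := nth a0 (fib c i) t.
  have cai : c a = i.
    by have := mem_nth a0 ti; rewrite mem_enum inE => /eqP.
  have posa : pos c a = t.
    by apply: val_inj; rewrite /= posE// cai /a index_uniq// enum_uniq.
  by have := FE a; rewrite !ffunE /= posa cai => -[].
rewrite -cardD -(card_in_imset FD).
have -> : ((k * q.+1)`! = #|[set f : {ffun 'I_n -> 'I_k * 'I_q.+1} | injectiveb f]|)%N.
  by rewrite card_inj_ffuns card_prod !card_ord ffactnn.
apply: subset_leq_card; apply/fintype.subsetP => _ /imsetP[[c s] + ->].
rewrite !inE andbT /= => cb; apply/injectiveP => a b.
rewrite !ffunE /= => -[cab]; rewrite cab => /perm_inj /(congr1 val).
rewrite /= !posE// cab => /(congr1 (nth a (fib c (c b)))).
by rewrite !nth_index// ?mem_enum ?inE ?cab.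
Qed.

(** The growth from [q] to [q.+1] in the induction below, last factor left out. With K = k+1 and i +
    r = K, a symmetric pair multiplies to K^2 (q^2 + q) + i r, where i r <= K^2 / 4, and (q^2 + q +
    1/4)(q + 2) <= (q + 1)^3. *)
Lemma prod_add_sqr_le (k q : nat) :
  ((\prod_(j < k) (k.+1 * q + j.+1)) ^ 2 * q.+2 ^ k <=
   q.+1 ^ k * ((k.+1 * q.+1) ^ 2) ^ k)%N.
Proof.
(* pair the j-th factor with the one symmetric to it *)
rewrite -mulnn {2}(reindex_inj rev_ord_inj) -big_split /= -expnMn.
rewrite -[k in (_ ^ k)%N]card_ord -prod_nat_const -big_split /=.
rewrite -[k in (_ ^ k)%N]card_ord -prod_nat_const.
apply: leq_prod => j _; have := ltn_ord j; set l := val j => ltlk.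
have -> : (k - l.+1).+1 = (k.+1 - l.+1)%N by lia.
have [r kr] : exists r, k.+1 = (l.+1 + r)%N by exists (k - l)%N; lia.
rewrite kr addKn; set i := l.+1.
have : (4 * (i * r) <= (i + r) * (i + r))%N.
  by have := (nat_AGM2 i r).1; rewrite -mulnn mulnA.
have -> : (((i + r) * q + i) * ((i + r) * q + r) =
  (i + r) * (i + r) * (q * q + q) + i * r)%N by ring.
rewrite expnMn -mulnn.
move: ((i + r) * (i + r))%N (i * r)%N => x y xy.
by nia.
Qed.

(** Squaring keeps the exponent k/2 of the central multinomial bound integral. *)
Lemma central_multinomial_sqr_le (k q : nat) :
  ((k.+1 * q)`! ^ 2 * q.+1 ^ k <= (q`! ^ k.+1 * k.+1 ^ (k.+1 * q)) ^ 2)%N.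
Proof.
elim: q => [|q IHq]; first by rewrite !(muln0, fact0, exp1n, expn0).
have factD p r : ((p + r)`! = p`! * \prod_(j < r) (p + j.+1))%N.
  elim: r => [|r IHr]; first by rewrite addn0 big_ord0 muln1.
  by rewrite addnS factS IHr big_ord_recr /= -addnS; ring.
rewrite {1}mulnS addnC factD big_ord_recr /=.
have -> : (k.+1 * q + k.+1 = k.+1 * q.+1)%N by rewrite mulnS addnC.
set p := \prod_(j < k) _; set s := (k.+1 * q.+1)%N.
have H := leq_mul IHq (prod_add_sqr_le k q).
(* The extra factor [q.+1 ^ k] completes the left side of the induction hypothesis; the top factor
   [s] is matched exactly. *)
rewrite -(leq_pmul2r (_ : 0 < q.+1 ^ k))%N ?expn_gt0//.
have -> : (((k.+1 * q)`! * (p * s)) ^ 2 * q.+2 ^ k * q.+1 ^ k =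
  ((k.+1 * q)`! ^ 2 * q.+1 ^ k * (p ^ 2 * q.+2 ^ k)) * s ^ 2)%N by ring.
apply: leq_trans (leq_mul H (leqnn _)) _.
have sE : ((s ^ 2) ^ k * s ^ 2 = (k.+1 ^ k.+1 * q.+1 ^ k.+1) ^ 2)%N.
  by rewrite -expnSr -expnM (mulnC 2) expnM /s (expnMn k.+1).
rewrite -!mulnA sE factS /s mulnS expnD (expnMn q.+1).
move: (q`! ^ k.+1)%N (q.+1 ^ k.+1)%N (q.+1 ^ k)%N => x y z.
move: (k.+1 ^ k.+1)%N (k.+1 ^ (k.+1 * q))%N => v w.
by rewrite eq_leq//; ring.
Qed.

Lemma card_balanced_sqr_le (k q : nat) :
  (#|[set c | @balanced (k.+1 * q) k.+1 c]| ^ 2 * q.+1 ^ k <=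
   (k.+1 ^ (k.+1 * q)) ^ 2)%N.
Proof.
have H1 := card_balanced q (ltn0Sn k).
have H2 := central_multinomial_sqr_le k q.
rewrite -(leq_pmul2l (_ : 0 < (q`! ^ k.+1) ^ 2)%N) ?expn_gt0 ?fact_gt0//.
rewrite mulnA -!expnMn [X in (X ^ 2)%N]mulnC.
apply: leq_trans H2; rewrite leq_mul2r; apply/orP; right.
by rewrite leq_sqr.
Qed.

(** * Favourite bundles on the grid *)

Section GridWeights.
Context {R : realType} {N m k : nat}.
Variables (w : 'I_N -> R) (eta : R).
Hypotheses (w_ge0 : forall r, 0 <= w r) (w_sum : \sum_r w r = 1)
  (w_le : forall r, w r <= eta).

(** The law of one agent's vector of rounded utilities, [w] being the law of a single one. *)
Definition grid_weight (y : {ffun 'I_m -> 'I_N}) : R := \prod_g w (y g).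

Definition bundle_sum (al : {ffun 'I_m -> 'I_k}) (y : {ffun 'I_m -> 'I_N})
  (i : 'I_k) : nat := (\sum_(g | al g == i) y g)%N.

(** The slack [m] absorbs rounding: a bundle has at most [m] goods, each losing at most one grid
    step. *)
Definition near_best (al : {ffun 'I_m -> 'I_k}) (y : {ffun 'I_m -> 'I_N})
  (i : 'I_k) : bool := [forall j, bundle_sum al y j <= bundle_sum al y i + m]%N.

Definition near_best_prob (al : {ffun 'I_m -> 'I_k}) (i : 'I_k) : R :=
  \sum_(y | near_best al y i) grid_weight y.

Lemma grid_weight_ge0 y : 0 <= grid_weight y.
Proof. by apply: prodr_ge0 => g _. Qed.

Lemma sum_grid_weight : \sum_y grid_weight y = 1.
Proof. by rewrite /grid_weight -(bigA_distr_bigA (fun _ => w)) big1. Qed.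

Lemma cell_bound_ge0 : 0 <= eta.
Proof.
case: (pickP 'I_N) => [r _|N0]; first exact: le_trans (w_le r).
by have := w_sum; rewrite big_pred0// => /esym/eqP; rewrite oner_eq0.
Qed.

Lemma near_best_prob_ge0 al i : 0 <= near_best_prob al i.
Proof. by apply: sumr_ge0 => y _; exact: grid_weight_ge0. Qed.

(** The condition says |t + a - b| <= m, so t + a + m - b is injective in t with values in 0..2m,
    and the truncated subtraction is exact. *)
Lemma card_near_sum (a b : nat) :
  (#|[set t : 'I_N | (t + a <= b + m) && (b <= t + a + m)]| <= 2 * m + 1)%N.
Proof.
rewrite addn1 -[X in (_ <= X)%N](card_ord (2 * m).+1).
pose f (t : 'I_N) : 'I_(2 * m).+1 := inord (t + a + m - b).
rewrite -(card_in_imset (f := f)) ?max_card// => t t'.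
rewrite !inE => /andP[h1 h2] /andP[h1' h2'] /(congr1 val).
by rewrite /= !inordK; [move=> h; apply: val_inj => /=; lia|lia|lia].
Qed.

(** With all goods but [g0] fixed, bundle [j] is constant and bundle [i] shifts with the cell of
    [g0], so a near tie leaves that cell at most 2m + 1 values, each of mass at most [eta]. *)
Lemma near_tie_prob (al : {ffun 'I_m -> 'I_k}) (i j : 'I_k) (g0 : 'I_m) :
  al g0 = i -> j != i ->
  \sum_(y | (bundle_sum al y i <= bundle_sum al y j + m)%N &&
            (bundle_sum al y j <= bundle_sum al y i + m)%N) grid_weight y
  <= (2 * m + 1)%:R * eta.
Proof.
move=> ali ji.
pose near_tie y := (bundle_sum al y i <= bundle_sum al y j + m)%N &&
  (bundle_sum al y j <= bundle_sum al y i + m)%N.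
rewrite (eq_bigl near_tie)//.
have eta_ge0 := cell_bound_ge0.
pose upd (y : {ffun 'I_m -> 'I_N}) t : {ffun 'I_m -> 'I_N} :=
  [ffun g => if g == g0 then t else y g].
pose V (y : {ffun 'I_m -> 'I_N}) := \prod_(g | g != g0) w (y g).
have V_ge0 y : 0 <= V y by apply: prodr_ge0.
have WE y : grid_weight y = w (y g0) * V y by rewrite /grid_weight (bigD1 g0).
have Wupd y t : grid_weight (upd y t) = w t * V y.
  rewrite WE ffunE eqxx; congr (_ * _); apply: eq_bigr => g /negPf gg0.
  by rewrite ffunE gg0.
(* resampling the value of g0: (y, t) |-> (upd y t, y g0) is an involution *)
pose swap (p : {ffun 'I_m -> 'I_N} * 'I_N) := (upd p.1 p.2, p.1 g0).
have swapK : involutive swap.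
  move=> [y t]; rewrite /swap /= ffunE eqxx; congr pair.
  by apply/ffunP => g; rewrite !ffunE; case: eqVneq => // ->.
(* The cell of [g0] is bounded by [eta]; the weight of the other goods is recovered by summing over
   all values of [g0]. *)
apply: (@le_trans _ _ (eta * \sum_(y | near_tie y) \sum_t grid_weight (upd y t))).
  rewrite mulr_sumr; apply: ler_sum => y _.
  under eq_bigr do rewrite Wupd.
  by rewrite -mulr_suml w_sum mul1r WE ler_wpM2r.
rewrite mulrC ler_wpM2r// pair_big_dep /=.
rewrite (reindex_inj (inv_inj swapK)) /=.
have swap2 p : upd (upd p.1 p.2) (p.1 g0) = p.1.
  by have /(congr1 fst) := swapK p.
under eq_bigr => p _ do rewrite swap2.
have -> : \sum_(p | near_tie (upd p.1 p.2) && true) grid_weight p.1 =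
    \sum_y \sum_(t | near_tie (upd y t)) grid_weight y.
  by rewrite pair_big_dep; apply: eq_bigl => p; rewrite andbT.
rewrite -[leRHS]mul1r -{1}sum_grid_weight mulr_suml.
apply: ler_sum => y _; rewrite sumr_const -[leLHS]mulr_natr.
rewrite ler_wpM2l ?grid_weight_ge0// ler_nat.
have bsi t : bundle_sum al (upd y t) i =
    (t + \sum_(g | (al g == i) && (g != g0)) y g)%N.
  rewrite /bundle_sum (bigD1 g0) ?ali//= ffunE eqxx; congr (_ + _)%N.
  by apply: eq_bigr => g /andP[_ /negPf gg0]; rewrite ffunE gg0.
have bsj t : bundle_sum al (upd y t) j = bundle_sum al y j.
  apply: eq_bigr => g /eqP alj; rewrite ffunE; case: eqVneq => // gg0.
  by move: ji; rewrite -alj gg0 ali eqxx.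
rewrite -[X in (X <= _)%N]cardsE; apply: leq_trans (card_near_sum
  (\sum_(g | (al g == i) && (g != g0)) y g) (bundle_sum al y j)).
apply: subset_leq_card; apply/fintype.subsetP => t.
by rewrite !inE unfold_in /near_tie /= bsi bsj.
Qed.

Lemma sum_near_best_prob (al : {ffun 'I_m -> 'I_k}) :
  (forall i, exists g, al g = i) ->
  \sum_i near_best_prob al i <= 1 + (k * k)%:R * ((2 * m + 1)%:R * eta).
Proof.
move=> al_surj.
have eta_ge0 := cell_bound_ge0.
pose tie y i j := [&& j != i, near_best al y i & near_best al y j].
(* If [i0] is near best, every other near-best bundle forms a tied pair with it. *)
have count y : (\sum_i near_best al y i <= 1 + \sum_i \sum_j tie y i j)%N.
  case: (pickP (near_best al y)) => [i0 i0b|nb]; last first.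
    by rewrite big1// => i _; rewrite nb.
  rewrite (bigD1 i0)//= [in leqRHS](bigD1 i0)//= i0b leq_add2l.
  apply: leq_trans (leq_addr _ _).
  rewrite [leqRHS](bigD1 i0)//= /tie eqxx add0n.
  by apply: leq_sum => i ii0; rewrite ii0 i0b.
have -> : \sum_i near_best_prob al i =
    \sum_y (\sum_i near_best al y i)%N%:R * grid_weight y.
  rewrite /near_best_prob.
  under eq_bigr do rewrite big_mkcond /=.
  rewrite exchange_big; apply: eq_bigr => y _ /=.
  rewrite natr_sum mulr_suml; apply: eq_bigr => i _.
  by case: near_best; rewrite ?mul1r ?mul0r.
apply: (@le_trans _ _
    (\sum_y (1 + \sum_i \sum_j tie y i j)%N%:R * grid_weight y)).
  by apply: ler_sum => y _; rewrite ler_wpM2r ?grid_weight_ge0// ler_nat.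
under eq_bigr do rewrite natrD mulrDl mul1r.
rewrite big_split /= sum_grid_weight lerD2l.
under eq_bigr do rewrite natr_sum mulr_suml.
rewrite exchange_big /=.
have -> : (k * k)%:R * ((2 * m + 1)%:R * eta) =
    \sum_(i : 'I_k) \sum_(j : 'I_k) (2 * m + 1)%:R * eta.
  by rewrite mulr_natl mulrnA !sumr_const !card_ord.
apply: ler_sum => i _.
under eq_bigr do rewrite natr_sum mulr_suml.
rewrite exchange_big /=; apply: ler_sum => j _.
have [->|ji] := eqVneq j i.
  by rewrite big1 ?mulr_ge0// => y _; rewrite /tie eqxx mul0r.
have [g0 alg0] := al_surj i.
apply: le_trans (near_tie_prob alg0 ji).
rewrite [leRHS]big_mkcond; apply: ler_sum => y _; rewrite /tie ji /=.
case: (boolP (near_best al y i)) => [/forallP/(_ j) hi|_]; last first.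
  by rewrite mul0r; case: ifP; rewrite ?grid_weight_ge0.
case: (boolP (near_best al y j)) => [/forallP/(_ i) hj|_]; last first.
  by rewrite mul0r; case: ifP; rewrite ?grid_weight_ge0.
by rewrite hi hj mul1r.
Qed.

End GridWeights.

(** Each colour occurs n/k times, so the product is (prod_i p_i)^(n/k), and AM-GM applies to the k
    numbers p_i. *)
Lemma prod_balanced_le (R : realType) (n k : nat) (c : {ffun 'I_n -> 'I_k})
    (p : 'I_k -> R) : (k %| n)%N -> balanced c -> (forall i, 0 <= p i) ->
  \prod_a p (c a) <= ((\sum_i p i) / k%:R) ^+ n.
Proof.
move=> kn cb p_ge0.
have -> : \prod_a p (c a) = (\prod_i p i) ^+ (n %/ k).
  rewrite (partition_big c predT)//= -prodrXl; apply: eq_bigr => i _.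
  under eq_bigr => a /eqP -> do [].
  by rewrite prodr_const -(eqP (forallP cb i)) cardsE.
rewrite -[in leRHS](divnK kn) mulnC exprM lerXn2r ?nnegrE//.
- by apply: prodr_ge0.
- by rewrite exprn_ge0// divr_ge0// sumr_ge0.
- have /= := (@leif_AGM _ _ [set: 'I_k] p (fun i _ => p_ge0 i)).1.
  rewrite cardsT card_ord.
  under eq_bigl do rewrite inE.
  by under [X in (X / _) ^+ _]eq_bigl do rewrite inE.
Qed.

Local Open Scope classical_set_scope.
Local Open Scope ring_scope.

(** * Support and grid cells of the utility distribution *)

Section Distribution.
Context {R : realType}.
Variable D : probability R R.

(** Every point of [U] has a null neighbourhood, hence lies in a null interval with rational
    endpoints; there are only countably many of these. *)
Lemma open_disjoint_support_eq0 (U : set R) :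
  open U -> (forall x, U x -> ~ dist_support D x) -> D U = 0%E.
Proof.
move=> oU Unsupp.
pose B (q : rat * rat) : set R := `]ratr q.1, ratr q.2[%classic.
pose G (n : nat) : set R :=
  if unpickle n is Some q then if D (B q) == 0%E then B q else set0 else set0.
apply: measure_negligible; first exact: open_measurable.
apply: (@negligibleS _ _ _ D (\bigcup_n G n)); last first.
  apply: negligible_bigcup => n; rewrite /G.
  case: unpickle => [q|]; last exact: negligible_set0.
  case: eqP => [Bq0|_]; last exact: negligible_set0.
  by apply/negligibleP => //; exact: measurable_itv.
move=> x Ux; have := Unsupp x Ux.
move=> /existsNP[V /not_implyP[oV /not_implyP[Vx DV]]].
have DV0 : D V = 0%E.
  by apply/eqP; rewrite eq_le measure_ge0 andbT leNgt; apply/negP.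
have /nbhs_ballP[e /= e0 eV] := open_nbhs_nbhs (conj oV Vx).
have [r] : exists r, ratr r \in `]x - e, x[ by apply: rat_in_itvoo; lra.
have [s] : exists s, ratr s \in `]x, x + e[ by apply: rat_in_itvoo; lra.
rewrite !in_itv /= => /andP[xs se] /andP[er rx].
exists (pickle (r, s)); first exact: I.
rewrite /G pickleK.
have -> : D (B (r, s)) == 0%E.
  rewrite -measure_le0 -DV0 le_measure ?inE//.
  - exact: measurable_itv.
  - exact: open_measurable.
  - apply: subset_trans eV => y; rewrite /B /= in_itv /= => /andP[? ?].
    by rewrite /ball /= ltr_norml; apply/andP; split; lra.
by rewrite /B; apply/andP; rewrite !bnd_simp.
Qed.

(** Dropping the null point 0 makes utilities strictly positive and fits the left-open grid
    cells. *)
Lemma compl_oc_unit_eq0 : non_atomic D -> dist_support D `<=` `[0, 1]%classic ->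
  D (~` `]0, 1]%classic) = 0%E.
Proof.
move=> na supp.
apply: measure_negligible; first exact: measurableC.
apply: (@negligibleS _ _ _ D (`]-oo, 0[%classic `|` ([set 0] `|` `]1, +oo[%classic))).
  move=> x /= /negP; rewrite !in_itv /= negb_and -leNgt -ltNge andbT.
  move=> /orP[|->]; last by right; right.
  by rewrite le_eqVlt => /orP[/eqP ->|->]; [right; left|left].
apply: negligibleU; last apply: negligibleU.
- apply/negligibleP; first exact: measurable_itv.
  apply: open_disjoint_support_eq0 => [|x]; first exact: interval_open.
  by rewrite /= in_itv /= => x0 /supp; rewrite /= in_itv /= => /andP[]; lra.
- by apply/negligibleP; [exact: measurable_set1|exact: na].
- apply/negligibleP; first exact: measurable_itv.
  apply: open_disjoint_support_eq0 => [|x]; first exact: interval_open.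
  by rewrite /= in_itv /= andbT => x0 /supp; rewrite /= in_itv /= => /andP[]; lra.
Qed.

(** Continuity from above along balls shrinking to the null set {x}. *)
Lemma small_ball (x e : R) : non_atomic D -> 0 < e ->
  exists2 r, 0 < r & (D (ball x r) < e%:E)%E.
Proof.
move=> na e0.
pose F n := ball x n.+1%:R^-1.
have F_cap : \bigcap_n F n = [set x].
  apply/seteqP; split=> [y Fy|_ -> n _]; last by apply: ballxx; rewrite invr_gt0.
  apply: contrapT => yx; have d0 : 0 < `|x - y|.
    by rewrite normr_gt0 subr_eq0; apply/eqP => /esym.
  have := Fy (Num.bound (`|x - y|^-1)) I.
  rewrite /F /ball /= => /ltW; rewrite leNgt => /negP; apply.
  rewrite -[ltRHS]invrK ltf_pV2 ?posrE ?invr_gt0 ?ltr0n//.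
  apply: (lt_trans (archi_boundP _)); first by rewrite invr_ge0.
  by rewrite ltr_nat.
have : D \o F @ \oo --> D (\bigcap_n F n).
  apply: nonincreasing_cvg_mu => //.
  - by rewrite (le_lt_trans (probability_le1 _ _)) ?ltry//; exact: measurable_ball.
  - by move=> n; exact: measurable_ball.
  - by rewrite F_cap.
  - move=> n p np; apply/subsetPset/le_ball.
    by rewrite lef_pV2 ?posrE ?ltr0n// ler_nat.
rewrite F_cap na => F0; apply: contrapT => noF.
have : (e%:E <= 0)%E.
  apply: (cvge_ge _ F0); apply: nearW => n /=.
  rewrite leNgt; apply/negP => Fn; apply: noF.
  by exists n.+1%:R^-1 => //; rewrite invr_gt0.
by rewrite lee_fin leNgt e0.
Qed.

Definition grid_cell (N : nat) (r : 'I_N) : set R :=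
  `](r : nat)%:R / N%:R, r.+1%:R / N%:R]%classic.

Lemma measurable_grid_cell N (r : 'I_N) : measurable (grid_cell r).
Proof. exact: measurable_itv. Qed.

Lemma grid_cellP (N : nat) (x : R) : (0 < N)%N -> 0 < x <= 1 ->
  exists r : 'I_N, grid_cell r x.
Proof.
move=> N0 /andP[x0 x1].
have N0' : 0 < N%:R :> R by rewrite ltr0n.
(* Minimality of the least such n gives the strict lower bound n < x N. *)
have ex : exists n, x * N%:R <= n.+1%:R.
  exists N; rewrite (le_trans (_ : _ <= N%:R))// ?ler_nat//.
  by rewrite ler_piMl// ltW.
have nN : (ex_minn ex < N)%N.
  case: ex_minnP => n _ nmin; rewrite -(prednK N0) ltnS; apply: nmin.
  by rewrite prednK// ler_piMl// ltW.
exists (Ordinal nN); rewrite /grid_cell /= in_itv /=.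
case: ex_minnP nN => -[|n] xn min nN /=.
  by rewrite mul0r x0 ler_pdivlMr.
rewrite ler_pdivlMr// xn andbT ltr_pdivrMr// ltNge; apply/negP => xn'.
by have := min n xn'; rewrite ltnn.
Qed.

Lemma grid_cell_disjoint (N : nat) (r s : 'I_N) (x : R) :
  grid_cell r x -> grid_cell s x -> r = s.
Proof.
have key (i j : 'I_N) : grid_cell i x -> grid_cell j x -> (i <= j)%N.
  rewrite /grid_cell /= !in_itv /= => /andP[+ _] /andP[_ +].
  have N0 : 0 < N%:R :> R by rewrite ltr0n (leq_ltn_trans _ (ltn_ord i)).
  rewrite ltr_pdivrMr// ler_pdivlMr// => ix xj.
  by have := lt_le_trans ix xj; rewrite ltr_nat ltnS.
by move=> rx sx; apply/val_inj/eqP; rewrite eqn_leq !key.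
Qed.

Definition cell_prob (N : nat) (r : 'I_N) : R := fine (D (grid_cell r)).

Lemma cell_probE N (r : 'I_N) : D (grid_cell r) = (cell_prob r)%:E.
Proof. by rewrite fineK// fin_num_measure//; exact: measurable_grid_cell. Qed.

Lemma cell_prob_ge0 N (r : 'I_N) : 0 <= cell_prob r.
Proof. by rewrite fine_ge0. Qed.

Lemma sum_cell_prob N : (0 < N)%N -> D (~` `]0, 1]%classic) = 0%E ->
  \sum_(r : 'I_N) cell_prob r = 1.
Proof.
move=> N0 D01; apply: EFin_inj; rewrite -sumEFin.
under eq_bigr do rewrite -cell_probE.
rewrite -measure_bigsetU_ord//; last 2 first.
- by move=> r; exact: measurable_grid_cell.
- by move=> r s _ _ [x [rx sx]]; exact: grid_cell_disjoint rx sx.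
have -> : \big[setU/set0]_(r < N) @grid_cell N r = `]0, 1]%classic.
  rewrite -(@bigcup_pred _ _ predT); apply/seteqP; split => x /=.
    move=> [r _]; rewrite /grid_cell /= !in_itv /= => /andP[rx xr].
    have N0' : 0 < N%:R :> R by rewrite ltr0n.
    rewrite (le_lt_trans _ rx) ?divr_ge0//= (le_trans xr)//.
    by rewrite ler_pdivrMr// mul1r ler_nat.
  by rewrite in_itv /= => x01; have [r xr] := grid_cellP N0 x01; exists r.
change (D `]0, 1]%classic = 1%E).
have := probability_setC D (measurable_itv `]0, 1]).
rewrite D01 -[D `]0, 1]%classic]fineK ?fin_num_measure//.
by rewrite -EFinB => -[/esym/eqP]; rewrite subr_eq0 => /eqP <-.
Qed.

(** Compactness of [[0, 1]] makes the radius of [small_ball] uniform, and each cell lies in the ball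
    about its right endpoint whose radius is the mesh. *)
Lemma small_cells (e : R) : non_atomic D -> 0 < e ->
  exists2 N, (0 < N)%N & forall r : 'I_N, cell_prob r <= e.
Proof.
move=> na e0.
have [N _ NP] : \forall N \near \oo, forall x : R, `[0, 1]%classic x ->
    (D (ball x N.+1%:R^-1) < e%:E)%E.
  have cpt : compact (`[0, 1] : set R) := @segment_compact R 0 1.
  move/compact_near_coveringP : cpt.
  move=> /(_ nat \oo (fun N x => (D (ball x N.+1%:R^-1) < e%:E)%E)).
  apply => x _; have [r r0 xr] := small_ball x na e0.
  have r2 : 0 < r / 2 by rewrite divr_gt0.
  near=> y N => /=.
  apply: le_lt_trans xr; rewrite le_measure ?inE//; try exact: measurable_ball.
  move=> z /= yz; rewrite [r]splitr; apply: (@ball_triangle _ _ y).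
    by near: y; exact: nbhsx_ballx.
  apply: le_ball yz; near: N; exists (Num.bound (r / 2)^-1) => // N /= rN.
  rewrite -[leRHS]invrK lef_pV2 ?posrE ?invr_gt0 ?ltr0n//.
  apply/ltW/(lt_le_trans (archi_boundP _)); first by rewrite invr_ge0 ltW.
  by rewrite ler_nat (leq_trans rN).
exists N.+1 => // r.
pose x : R := r.+1%:R / N.+1%:R.
have x01 : `[0, 1]%classic x.
  rewrite /= in_itv /= divr_ge0//= ler_pdivrMr ?ltr0n// mul1r ler_nat.
  exact: ltn_ord.
rewrite -lee_fin -cell_probE; apply/ltW/(le_lt_trans _ (NP N (leqnn N) x x01)).
rewrite le_measure ?inE//.
- exact: measurable_grid_cell.
- exact: measurable_ball.
- move=> y; rewrite /grid_cell /x /ball /= in_itv /= => /andP[ry yr].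
  have N_gt0 : 0 < N.+1%:R^-1 :> R by rewrite invr_gt0.
  move: ry yr; rewrite -[r.+1%:R]natr1 mulrDl mul1r.
  move: (r%:R / _) N_gt0 => a; move: N.+1%:R^-1 => b b_gt0 ay yab.
  by rewrite ltr_norml; apply/andP; split; lra.
Unshelve. all: end_near.
Qed.

End Distribution.

(** * Probability of a fixed outcome *)

Section FiniteUnion.
Context d (T : measurableType d) (R : realType) (mu : {measure set T -> \bar R}).
Context (I : finType).

Lemma measure_bigsetU_le (p : pred I) (F : I -> set T) :
  (forall i, measurable (F i)) ->
  (mu (\big[setU/set0]_(i | p i) F i) <= \sum_(i | p i) mu (F i))%E.
Proof.
move=> mF; elim: (index_enum I) => [|i s IHs]; first by rewrite !big_nil measure0.
rewrite !big_cons; case: ifP => // _.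
have mFs : measurable (\big[setU/set0]_(j <- s | p j) F j).
  exact: bigsetU_measurable.
by apply: le_trans (measureU2 _ (mF i) mFs) _; rewrite leeD2l.
Qed.

Lemma measurable_forall (F : I -> set T) :
  (forall i, measurable (F i)) -> measurable [set w | forall i, F i w].
Proof.
move=> mF; rewrite (_ : mkset _ = \bigcap_(i in [set: I]) F i).
  by apply: fin_bigcap_measurable.
by apply/seteqP; split => w /= h i; have := h i; [|apply].
Qed.

End FiniteUnion.

Section PreferenceEvent.
Context d (T : measurableType d) (R : realType) (P : probability T R).
Context (D : probability R R) (n m k : nat) (u : 'I_n -> 'I_m -> {RV P >-> R}).

Definition prefer_event (al : {ffun 'I_m -> 'I_k}) (c : {ffun 'I_n -> 'I_k}) :
  set T := [set w | forall a j,
    \sum_(g | al g == j) u a g w <= \sum_(g | al g == c a) u a g w].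

Lemma measurable_prefer_event al c : measurable (prefer_event al c).
Proof.
apply: measurable_forall => a; apply: measurable_forall => j.
rewrite -[X in measurable X]setTI; apply: measurable_fun_le => //;
by under eq_fun do rewrite -big_filter; exact: measurable_sum.
Qed.

Hypotheses (u_iid : iid_utilities D u) (na : non_atomic D)
  (supp : dist_support D `<=` `[0, 1]%classic).

Definition outside_event : set T :=
  \big[setU/set0]_(p : 'I_n * 'I_m) (u p.1 p.2 @^-1` (~` `]0, 1]%classic)).

Lemma measurable_outside_event : measurable outside_event.
Proof.
apply: bigsetU_measurable => p _; apply: measurable_funPTI.
exact: measurableC.
Qed.

Lemma outside_event_eq0 : P outside_event = 0%E.
Proof.
apply/eqP; rewrite -measure_le0 /outside_event.
apply: le_trans (measure_bigsetU_le _ _ _) _.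
  by move=> p; apply: measurable_funPTI; exact: measurableC.
rewrite big1// => p _.
by have /= <- := compl_oc_unit_eq0 na supp; apply: u_iid.2; exact: measurableC.
Qed.

Lemma notin_outside_event w a g : ~ outside_event w -> 0 < u a g w <= 1.
Proof.
move=> ow; apply: contrapT => uag; apply: ow.
by rewrite /outside_event -(@bigcup_pred _ _ predT); exists (a, g).
Qed.

(** Off a null set, the event is covered by the boxes [F x] in which each agent's rounded utilities
    make the assigned bundle near best; independence gives the mass of each box. *)
Lemma prefer_event_le (al : {ffun 'I_m -> 'I_k}) (c : {ffun 'I_n -> 'I_k}) N :
  (0 < N)%N ->
  (P (prefer_event al c) <=
   (\prod_a near_best_prob (@cell_prob _ D N) al (c a))%:E)%E.
Proof.
move=> N0.
pose F (x : {ffun 'I_n -> {ffun 'I_m -> 'I_N}}) : set T :=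
  [set w | forall p : 'I_n * 'I_m, p \in [set: 'I_n * 'I_m]%SET ->
     grid_cell (x p.1 p.2) (u p.1 p.2 w)].
have mF x : measurable (F x).
  apply: measurable_forall => p; rewrite (_ : (fun _ => _) =
    u p.1 p.2 @^-1` grid_cell (x p.1 p.2)).
    by apply: measurable_funPTI; exact: measurable_grid_cell.
  apply/seteqP; split => w /= h; last by move=> _.
  by apply: h; rewrite finset.in_setT.
have PF x : P (F x) = (\prod_a grid_weight (@cell_prob _ D N) (x a))%:E.
  rewrite /F (u_iid.1 _ (fun p => grid_cell (x p.1 p.2))); last first.
    by move=> p; exact: measurable_grid_cell.
  rewrite pair_bigA /= -prodEFin.
  under eq_bigl do rewrite inE.
  apply: eq_bigr => p _; rewrite -cell_probE.
  by apply: u_iid.2; exact: measurable_grid_cell.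
pose good (x : {ffun 'I_n -> {ffun 'I_m -> 'I_N}}) :=
  [forall a, near_best al (x a) (c a)].
have sub : prefer_event al c `<=`
    outside_event `|` \big[setU/set0]_(x | good x) F x.
  move=> w Ew; have [|/notin_outside_event uw] := pselect (outside_event w).
    by left.
  right.
  have /choice[x0 x0P] (p : 'I_n * 'I_m) :
      exists r : 'I_N, grid_cell r (u p.1 p.2 w).
    by apply: grid_cellP.
  pose x : {ffun 'I_n -> {ffun 'I_m -> 'I_N}} := [ffun a => [ffun g => x0 (a, g)]].
  rewrite -bigcup_pred; exists x; last by move=> [a g] _ /=; rewrite !ffunE.
  apply/forallP => a; apply/forallP => j.
  have N0' : 0 < N%:R :> R by rewrite ltr0n.
  have cell g : (x a g)%:R < N%:R * u a g w <= (x a g).+1%:R.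
    have := x0P (a, g); rewrite /grid_cell /= in_itv /= !ffunE.
    by rewrite ltr_pdivrMr// ler_pdivlMr// mulrC.
  rewrite -(ler_nat R) natrD /bundle_sum !natr_sum.
  apply: (@le_trans _ _ (N%:R * \sum_(g | al g == j) u a g w)).
    by rewrite mulr_sumr; apply: ler_sum => g _; apply/ltW; case/andP: (cell g).
  apply: (@le_trans _ _ (N%:R * \sum_(g | al g == c a) u a g w)).
    by rewrite ler_wpM2l// ltW.
  rewrite mulr_sumr.
  apply: (@le_trans _ _ (\sum_(g | al g == c a) ((x a g)%:R + 1))).
    by apply: ler_sum => g _; rewrite natr1; case/andP: (cell g).
  rewrite big_split /= lerD2l sumr_const ler_nat -[leqRHS]card_ord.
  exact: max_card.
have mG : measurable (\big[setU/set0]_(x | good x) F x).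
  exact: bigsetU_measurable.
apply: (@le_trans _ _ (P (outside_event `|` \big[setU/set0]_(x | good x) F x))).
  rewrite le_measure ?inE//; first exact: measurable_prefer_event.
  by apply: measurableU => //; exact: measurable_outside_event.
apply: le_trans (measureU2 _ measurable_outside_event mG) _.
rewrite [X in (X + _)%E]outside_event_eq0 add0e.
apply: le_trans (measure_bigsetU_le _ _ mF) _.
rewrite (eq_bigr _ (fun x _ => PF x)).
(* The condition on [x] is separate for each agent, so the sum over boxes factors into a product
   over agents. *)
rewrite sumEFin lee_fin /near_best_prob bigA_distr_big_dep /=.
rewrite le_eqVlt; apply/orP; left; apply/eqP; apply: eq_bigl => x.
by apply/forallP/familyP.
Qed.

End PreferenceEvent.

(** * Outcomes as pairs of colourings, and the probability that one is envy-free *)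

Lemma labelled_partition_fibers (T : finType) (k : nat) (X : 'I_k -> {set T}) :
  labelled_partition X ->
  exists f : {ffun T -> 'I_k}, forall x i, (x \in X i) = (f x == i).
Proof.
move=> [disj cov]; have /choice[f fP] := cov; exists [ffun x => f x] => x i.
rewrite ffunE; apply/idP/eqP => [xi|<-//]; apply: contrapT => /eqP fi.
by have /disjointFr/(_ (fP x)) := disj _ _ fi; rewrite xi.
Qed.

Lemma fibers_labelled_partition (T : finType) (k : nat) (f : {ffun T -> 'I_k}) :
  labelled_partition (fun i => [set x | f x == i]%SET).
Proof.
split=> [i j ij|x]; last by exists (f x); rewrite inE.
apply/pred0P => x /=; rewrite !inE; apply/negP => /andP[/eqP -> /eqP ij'].
by rewrite ij' eqxx in ij.
Qed.

Section EnvyFreeEvent.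
Context d (T : measurableType d) (R : realType) (P : probability T R).
Context (D : probability R R) (n m k : nat) (u : 'I_n -> 'I_m -> {RV P >-> R}).

Definition envy_free_event : set T :=
  [set w | envy_free_outcome_exists k (fun a g => u a g w)].

(** Colourings form a finite type, so this form yields both measurability and the union bound. *)
Lemma envy_free_eventE : envy_free_event =
  \big[setU/set0]_(p : {ffun 'I_m -> 'I_k} * {ffun 'I_n -> 'I_k} | balanced p.2)
    prefer_event u p.1 p.2.
Proof.
rewrite -(@bigcup_pred _ _ (fun p => balanced p.2)); apply/seteqP; split=> w /=.
  move=> [C [A [[/labelled_partition_fibers[c cP] Ck
    /labelled_partition_fibers[al alP]] ef]]].
  exists (al, c) => /=.
    apply/forallP => i; rewrite -(Ck i); apply/eqP/eq_card => a.
    by rewrite inE cP.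
  move=> a j; have := ef (c a) j a; rewrite cP eqxx => /(_ isT).
  rewrite /bundle_utility.
  by under eq_bigl do rewrite alP; under [leRHS]eq_bigl do rewrite alP.
move=> [[al c] /forallP /= cb pref].
exists (fun i => [set a | c a == i]%SET), (fun i => [set g | al g == i]%SET).
split.
  split; [exact: fibers_labelled_partition| |exact: fibers_labelled_partition].
  by move=> i; exact/eqP/cb.
move=> i j a; rewrite inE => /eqP <-; rewrite /bundle_utility.
have fiberE l : \sum_(g in [set g | al g == l]%SET) u a g w =
    \sum_(g | al g == l) u a g w by apply: eq_bigl => g; rewrite inE.
by rewrite !fiberE; exact: pref.
Qed.

Lemma measurable_envy_free_event : measurable envy_free_event.
Proof.
rewrite envy_free_eventE; apply: bigsetU_measurable => p _.
exact: measurable_prefer_event.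
Qed.

Hypotheses (u_iid : iid_utilities D u) (na : non_atomic D)
  (supp : dist_support D `<=` `[0, 1]%classic).
Hypotheses (k_gt0 : (0 < k)%N) (kn : (k %| n)%N).

Lemma prefer_event_surjective_le (al : {ffun 'I_m -> 'I_k})
    (c : {ffun 'I_n -> 'I_k}) :
  balanced c -> (forall i, exists g, al g = i) ->
  (P (prefer_event u al c) <= (k%:R^-1 ^+ n)%:E)%E.
Proof.
move=> cb al_surj.
have fin : P (prefer_event u al c) \is a fin_num.
  by rewrite fin_num_measure//; exact: measurable_prefer_event.
(* A probability above k^-n would exceed ((1 + e) / k)^n for some e > 0 by continuity at 0; a fine
   enough grid refutes this. *)
rewrite -(fineK fin) lee_fin leNgt; apply/negP => lt_p.
pose f (e : R) := ((1 + e) / k%:R) ^+ n.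
have f0 : f e @[e --> 0^'+] --> f 0.
  apply: cvg_at_right_filter.
  suff : {for (0 : R), continuous
    ((fun x : R => x ^+ n) \o (fun e : R => (1 + e) / k%:R))} by [].
  apply: continuous_comp; last exact: exprn_continuous.
  by apply: cvgMl; apply: cvgD; [exact: cvg_cst|exact: cvg_id].
have near_lt : \forall e \near 0^'+,
    f e < fine (P (prefer_event u al c)) /\ 0 < e.
  near=> e; split; last by near: e; exact: nbhs_right_gt.
  by near: e; apply: (cvgr_lt _ f0); rewrite /f addr0 mul1r.
have [e [+ e0]] := @filter_ex _ _ (at_right_proper_filter (0 : R)) _ near_lt.
apply/negP; rewrite -leNgt -lee_fin fineK//.
have K0 : 0 < (k * k)%:R * (2 * m + 1)%:R :> R.
  by rewrite mulr_gt0// ltr0n ?muln_gt0 ?k_gt0// addn1.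
(* This cell mass makes the excess in [sum_near_best_prob] at most [e]. *)
have [N N0 small] := small_cells na (divr_gt0 e0 K0).
apply: le_trans (prefer_event_le u_iid na supp al c N0) _; rewrite lee_fin.
have w_ge0 := @cell_prob_ge0 _ D N.
have w_sum := sum_cell_prob N0 (compl_oc_unit_eq0 na supp).
apply: le_trans (prod_balanced_le kn cb (near_best_prob_ge0 w_ge0 al)) _.
rewrite lerXn2r ?nnegrE//.
- by rewrite divr_ge0// sumr_ge0// => i _; exact: near_best_prob_ge0.
- by rewrite divr_ge0// addr_ge0// ltW.
rewrite ler_pM2r ?invr_gt0 ?ltr0n//.
apply: le_trans (sum_near_best_prob w_ge0 w_sum small al_surj) _.
by rewrite lerD2l mulrA mulrCA divff ?mulr1// gt_eqF.
Unshelve. all: by end_near.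
Qed.

(** Group [i] is nonempty and its agents get 0 from the empty bundle, whereas a bundle holding some
    good has positive utility off [outside_event]. *)
Lemma prefer_event_missing_eq0 (al : {ffun 'I_m -> 'I_k})
    (c : {ffun 'I_n -> 'I_k}) (i : 'I_k) :
  balanced c -> (0 < n)%N -> (0 < m)%N -> (forall g, al g != i) ->
  P (prefer_event u al c) = 0%E.
Proof.
move=> /forallP/(_ i)/eqP ci n0 m0 al_i.
apply/eqP; rewrite -measure_le0 -(outside_event_eq0 u_iid na supp).
rewrite le_measure ?inE//; [exact: measurable_prefer_event|
  exact: measurable_outside_event|].
move=> w pref; apply: contrapT => /notin_outside_event uw.
have : (0 < #|[set a | c a == i]%SET|)%N.
  by rewrite ci divn_gt0// dvdn_leq.
case/card_gt0P => a; rewrite inE => /eqP ca.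
pose g0 := Ordinal m0.
have := pref a (al g0); rewrite leNgt => /negP; apply.
rewrite ca [ltLHS]big_pred0 => [|g]; last exact/negbTE.
rewrite (bigD1 g0)//= ltr_wpDr//; last by case/andP: (uw a g0).
by apply: sumr_ge0 => g _; apply/ltW; case/andP: (uw a g).
Qed.

Lemma envy_free_event_le : (0 < n)%N -> (0 < m)%N ->
  (P envy_free_event <=
   ((k ^ m * #|[set c | @balanced n k c]%SET|)%N%:R * k%:R^-1 ^+ n)%:E)%E.
Proof.
move=> n0 m0; rewrite envy_free_eventE.
apply: le_trans (measure_bigsetU_le _ _ _) _.
  by move=> p; exact: measurable_prefer_event.
apply: (@le_trans _ _ (\sum_(p : {ffun 'I_m -> 'I_k} * {ffun 'I_n -> 'I_k} |
    balanced p.2) (k%:R^-1 ^+ n)%:E)%E).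
  apply: lee_sum => -[al c] /= cb.
  have [al_surj|] := pselect (forall i, exists g, al g = i).
    exact: prefer_event_surjective_le.
  move=> /existsNP[i /forallNP al_i].
  rewrite (@prefer_event_missing_eq0 _ _ i)//=; last by move=> g; exact/eqP.
rewrite sumEFin lee_fin sumr_const mulr_natl ler_wpMn2l ?exprn_ge0//.
rewrite eq_leq// -[k in (k ^ m)%N]card_ord -[m in (_ ^ m)%N]card_ord -card_ffun.
rewrite -[#|{ffun 'I_m -> 'I_k}|]cardsT -cardsX; apply: eq_card => -[al c].
by rewrite !inE.
Qed.

End EnvyFreeEvent.

(** * The union bound *)

(** On taking logarithms, this follows from 4 m <= ln n and ln (k + 1) <= k. *)
Lemma expn_ln_le (R : realType) (k m n : nat) : (0 < n)%N ->
  m%:R <= ln (n%:R : R) / 4 -> (k.+1 ^ m)%N%:R ^+ 4 <= n%:R ^+ k :> R.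
Proof.
move=> n0 mn; have n0' : 0 < n%:R :> R by rewrite ltr0n.
have K0 : 0 < k.+1%:R :> R by rewrite ltr0n.
rewrite natrX -exprM -ler_ln ?posrE ?exprn_gt0// !lnXn//.
rewrite -[leLHS]mulr_natl -[leRHS]mulr_natl [leRHS]mulrC.
apply: ler_pM => //; first by rewrite ln_ge0// ler1n.
  by rewrite natrM -ler_pdivlMr.
by rewrite -natr1 addrC le_ln1Dx// (lt_le_trans (ltrN10 _)).
Qed.

(** The fourth power clears both the square root in the multinomial bound and the 1/4 in the bound
    on [m]. *)
Lemma union_bound_le (R : realType) (k m q : nat) : (0 < q)%N ->
  m%:R <= ln ((k.+1 * q)%N%:R : R) / 4 ->
  ((k.+1 ^ m * #|[set c | @balanced (k.+1 * q) k.+1 c]%SET|)%N%:R *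
     k.+1%:R^-1 ^+ (k.+1 * q)) ^+ 4 <= (k.+1%:R / q.+1%:R) ^+ k :> R.
Proof.
move=> q0 mn; set n := (k.+1 * q)%N; set B := #|_|.
have n0 : (0 < n)%N by rewrite muln_gt0.
have Kn0 : 0 < k.+1%:R ^+ n :> R by rewrite exprn_gt0.
have Q0 : 0 < q.+1%:R ^+ k :> R by rewrite exprn_gt0.
have hB : (B%:R * k.+1%:R^-1 ^+ n) ^+ 2 <= (q.+1%:R ^+ k)^-1 :> R.
  rewrite exprVn -[leRHS]div1r ler_pdivlMr// expr_div_n -mulrAC ler_pdivrMr ?exprn_gt0//.
  by rewrite mul1r -!natrX -natrM ler_nat; exact: card_balanced_sqr_le.
have hA : (k.+1 ^ m)%N%:R ^+ 4 <= (k.+1%:R * q.+1%:R) ^+ k :> R.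
  apply: le_trans (expn_ln_le k n0 mn) _.
  by rewrite lerXn2r ?nnegrE// -natrM ler_nat leq_mul2l leqnSn orbT.
rewrite natrM -mulrA exprMn.
apply: (@le_trans _ _ ((k.+1%:R * q.+1%:R) ^+ k * (q.+1%:R ^+ k)^-1 ^+ 2)).
  apply: ler_pM => //; rewrite ?exprn_ge0//.
  by rewrite (exprM _ 2 2) lerXn2r ?nnegrE ?exprn_ge0 ?invr_ge0.
rewrite exprMn expr_div_n expr2 mulrA mulfK ?gt_eqF//.
Qed.

(* Numbers of agents n range over the multiples of k; since 1 <= m <= ln n / 4
   is impossible for small n, the constraints on m are required for all large
   n only. *)
Theorem theorem3 (R : realType) (k : nat) (hk : (2 <= k)%N)
  (D : probability R R) (hD : non_atomic D)
  (hsupp : dist_support D `<=` `[0, 1])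
  (m : nat -> nat)
  (hm : \forall n \near within [set n | (k %| n)%N] \oo,
          (1 <= m n)%N /\ (m n)%:R <= ln (n%:R : R) / 4)
  (d : nat -> measure_display) (T : forall n, measurableType (d n))
  (P : forall n, probability (T n) R)
  (u : forall n, 'I_n -> 'I_(m n) -> {RV (P n) >-> R})
  (hu : forall n, (k %| n)%N -> iid_utilities D (u n)) :
  P n [set w | ~ envy_free_outcome_exists k (fun a g => u n a g w)]
    @[n --> within [set n | (k %| n)%N] \oo] --> 1%E.
Proof.
have PE n : P n [set w | ~ envy_free_outcome_exists k (fun a g => u n a g w)] =
    (1 - fine (P n (envy_free_event k (u n))))%:E.
  rewrite (_ : mkset _ = ~` envy_free_event k (u n))// probability_setC.
    rewrite EFinB fineK// fin_num_measure//; exact: measurable_envy_free_event.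
  exact: measurable_envy_free_event.
under eq_fun do rewrite PE.
apply: cvg_EFin; first exact: nearW.
apply/cvgrPdist_le => e e0.
case: k hk hm hu PE => // k hk hm hu _.
(* For [q] at least [M], the first summand makes the ratio (k+1)/(q+1) at most 1 and the second
   makes it at most e^4. *)
pose M := (k.+1 + Num.bound (k.+1%:R / e ^+ 4))%N.
have near_big : \forall n \near within [set n | (k.+1 %| n)%N] \oo,
    (k.+1 %| n)%N /\ (k.+1 * M <= n)%N.
  by exists (k.+1 * M)%N => // n.
near=> n.
have [kn Mn] : (k.+1 %| n)%N /\ (k.+1 * M <= n)%N by near: n.
have [m1 mn] : (1 <= m n)%N /\ (m n)%:R <= ln (n%:R : R) / 4 by near: n.
have /dvdnP[q nq] := kn; rewrite mulnC in nq.
have Mq : (M <= q)%N by rewrite -(leq_pmul2l (ltn0Sn k)) -nq.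
have q0 : (0 < q)%N by apply: leq_trans Mq; rewrite /M addSn.
have n0 : (0 < n)%N by rewrite nq muln_gt0.
rewrite opprB addrCA subrr addr0 ger0_norm ?fine_ge0//.
rewrite -lee_fin fineK; last first.
  by rewrite fin_num_measure//; exact: measurable_envy_free_event.
apply: le_trans (envy_free_event_le (hu n kn) hD hsupp (ltn0Sn k) kn n0 m1) _.
rewrite lee_fin -(@ler_pXn2r _ 4)// ?nnegrE ?mulr_ge0 ?exprn_ge0 ?(ltW e0)//.
move: (m n) mn; rewrite nq => m' mn; apply: le_trans (union_bound_le q0 mn) _.
have Q0 : 0 < q.+1%:R :> R by rewrite ltr0n.
have KQ1 : k.+1%:R / q.+1%:R <= 1 :> R.
  rewrite ler_pdivrMr// mul1r ler_nat leqW//.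
  by apply: leq_trans Mq; exact: leq_addr.
have KQe : k.+1%:R / q.+1%:R <= e ^+ 4.
  rewrite ler_pdivrMr// mulrC -ler_pdivrMr ?exprn_gt0//.
  apply/ltW/(lt_le_trans (archi_boundP _)); first by rewrite divr_ge0 ?exprn_ge0 ?ltW.
  by rewrite ler_nat leqW// (leq_trans (leq_addl _ _) Mq).
(* At least two groups means exponent [k] at least 1, so the power of a ratio at most 1 is bounded
   by the ratio. *)
by apply: le_trans KQe; rewrite ler_iXnr// divr_ge0.
Unshelve. all: by end_near.
Qed.
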